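(* Consider a hybrid maximizer with type $\theta\in(0,1)$, a private return-on-spend target $\gamma\ge 1$, and a regular valuation distribution $F$. There exists a corresponding standard utility maximizer drawing its valuation from a regular distribution $G$ such that, under any anonymous price $p>0$, both agents have identical purchasing probabilities and generate exactly the same expected revenue. That is, $\Pr_{z\sim G}[z\ge p]=\Pr_{v\sim F}[v\ge\tau_H(p)]$ for every $p>0$, where $\tau_H(p)$ is the hybrid maximizer's acceptance threshold at price $p$.
   Context: Valuations are drawn from a continuous CDF with a well-defined density on a non-negative support. Hybrid maximizer. An agent with type $\theta\in(0,1)$ maximizes expected acquired value minus $\theta$ times expected payment, subject to the return-on-spend (ROS) constraint that expected acquired value is at least $\gamma$ times expected payment. Facing a posted price $p$, it buys iff $v\ge\tau_H(p)$, where $$\tau_H(p)=\max(\theta p,\alpha(p)),\qquad \alpha(p)=\inf\{x\in\mathrm{supp}(F):\ \mathbb{E}_{v\sim F}[v\mid v\ge x]\ge\gamma p\},$$ with $\alpha(p)=\infty$ if the set is empty. Its expected revenue at price $p$ is $p\cdot\Pr[v\ge\tau_H(p)]$. Standard utility maximizer. With valuation $z\sim G$, it buys at price $p$ iff $z\ge p$; its expected revenue at price $p$ is $p\cdot\Pr[z\ge p]$. Regularity. A distribution $G$ is regular if its quantile revenue curve $q\mapsto q\,G^{-1}(1-q)$ is concave on $(0,1)$ ($G^{-1}$ the generalized inverse), equivalently, its virtual valuation $z-\frac{1-G(z)}{g(z)}$ is non-decreasing ($g$ the density). *)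

(* Defs.v *)
From HB Require Import structures.
From mathcomp Require Import all_boot all_order all_algebra.
From mathcomp Require Import all_classical all_reals all_analysis.
Import Order.TTheory GRing.Theory Num.Theory.
Import numFieldNormedType.Exports.

Set Implicit Arguments.
Unset Strict Implicit.
Unset Printing Implicit Defensive.

Local Open Scope classical_set_scope.
Local Open Scope ring_scope.

(* A distribution of valuations is a Borel probability measure on R.          *)
Notation distr R := (probability (measurableTypeR R) R).

Definition dcdf (R : realType) (F : distr R) (x : R) : R :=
  fine (F `]-oo, x]%classic).

Definition supp (R : realType) (F : distr R) : set R :=
  [set x | forall U : set R, open U -> U x -> (0 < F U)%E].

Definition has_density (R : realType) (F : distr R) : Prop :=
  exists f : R -> R,
    [/\ measurable_fun [set: R] f,
        (forall x, 0 <= f x) &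
        (forall A : set R, measurable A ->
           F A = \int[@lebesgue_measure R]_(x in A) (f x)%:E)%E].

Definition valuation_distr (R : realType) (F : distr R) : Prop :=
  [/\ continuous (dcdf F),
      has_density F &
      supp F `<=` [set x | 0 <= x]].

(* Generalized inverse of the CDF; meaningful for u in ]0, 1[, where the set  *)
(* is nonempty and bounded below.                                             *)
Definition quantile (R : realType) (F : distr R) (u : R) : R :=
  inf [set x | u <= dcdf F x].

Definition revenue_curve (R : realType) (F : distr R) (q : R) : R :=
  q * quantile F (1 - q).

Definition concave_function (R : realType) (D : set R) (f : R -> R) : Prop :=
  @convex_function R R^o D (fun x => - f x).

Definition regular (R : realType) (F : distr R) : Prop :=
  concave_function `]0, 1[%classic (revenue_curve F).

(* E[v | v >= x] for v ~ F, possibly +oo since no finite mean is assumed.     *)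
(* When Pr[v >= x] = 0 the conditional expectation is undefined and this      *)
(* expression is 0, hence such an x never meets a target gamma * p > 0.       *)
Definition tail_mean (R : realType) (F : distr R) (x : R) : \bar R :=
  (((fine (F `[x, +oo[%classic))^-1)%:E * \int[F]_(v in `[x, +oo[%classic) v%:E)%E.

(* Infimum in \bar R: it is +oo when no x in the support qualifies.           *)
Definition alpha (R : realType) (F : distr R) (gamma p : R) : \bar R :=
  ereal_inf
    (EFin @` [set x | supp F x /\ ((gamma * p)%:E <= tail_mean F x)%E]).

Definition tauH (R : realType) (F : distr R) (theta gamma p : R) : \bar R :=
  maxe (theta * p)%:E (alpha F gamma p).

Definition hybrid_purchase_prob (R : realType) (F : distr R)
    (theta gamma p : R) : \bar R :=
  F [set v : R | (tauH F theta gamma p <= v%:E)%E].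

Definition hybrid_revenue (R : realType) (F : distr R)
    (theta gamma p : R) : \bar R :=
  (p%:E * hybrid_purchase_prob F theta gamma p)%E.

Definition standard_purchase_prob (R : realType) (G : distr R) (p : R) :
    \bar R :=
  G [set z : R | p <= z].

Definition standard_revenue (R : realType) (G : distr R) (p : R) : \bar R :=
  (p%:E * standard_purchase_prob G p)%E.

(* Main.v *)
Require Import Defs.
From mathcomp Require Import all_boot all_order all_algebra.
From mathcomp Require Import all_classical all_reals all_analysis.
From mathcomp Require Import measurable_realfun.
From mathcomp Require Import ring lra.
Import Order.TTheory GRing.Theory Num.Theory.
Import numFieldNormedType.Exports.

Set Implicit Arguments.
Unset Strict Implicit.
Unset Printing Implicit Defensive.

Local Open Scope classical_set_scope.
Local Open Scope ring_scope.

(* Let M x = E[v | v >= x] and let G be the law of T v for v ~ F, where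
   T x = min (x / theta) (M x / gamma).  As M is nondecreasing, the hybrid
   maximizer buys at price p iff p <= T v, up to an F-null event.  Writing Q for
   the quantile function of F, T is nondecreasing and left continuous, so the
   revenue curve of G is q * T (Q (1 - q)), the minimum of
     q * Q (1 - q) / theta    and    (1 / gamma) * E[v; v >= Q (1 - q)].
   The first is concave by regularity of F, the second because it integrates the
   nonincreasing function Q (1 - s) over s in [0, q].  When F has infinite mean,
   the return-on-spend constraint never binds and T x = x / theta. *)

(** * Concave functions on a convex set of reals *)

Section concave.
Context {R : realType}.
Implicit Types (D : set R) (f g : R -> R).

Lemma concave_functionP D f : concave_function D f <->
  forall t x y, 0 <= t <= 1 -> D x -> D y ->
    t * f x + (1 - t) * f y <= f (t * x + (1 - t) * y).
Proof.
split=> [cf t x y /andP[t0 t1] Dx Dy|cf t x y].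
  have := cf (Itv01 t0 t1) x y; rewrite !inE => /(_ Dx Dy).
  have convE (a b : R^o) : conv (Itv01 t0 t1) a b = t * a + (1 - t) * b by [].
  by rewrite !convE !mulrN -opprD lerN2.
rewrite !inE => Dx Dy.
have convE (a b : R^o) : conv t a b = t%:num * a + (1 - t%:num) * b by [].
rewrite !convE !mulrN -opprD lerN2; apply: cf => //.
by apply/andP; split.
Qed.

Lemma eq_concave_function D f g :
  (forall t x y, 0 <= t <= 1 -> D x -> D y -> D (t * x + (1 - t) * y)) ->
  {in D, f =1 g} -> concave_function D f -> concave_function D g.
Proof.
move=> cD fg /concave_functionP cf; apply/concave_functionP => t x y t01 Dx Dy.
rewrite -!fg ?inE//; [exact: cf|exact: cD].
Qed.

Lemma concave_min D f g : concave_function D f -> concave_function D g ->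
  concave_function D (fun x => Num.min (f x) (g x)).
Proof.
move=> /concave_functionP cf /concave_functionP cg.
apply/concave_functionP => t x y t01 Dx Dy; move: (t01) => /andP[t0 t1].
have t1' : 0 <= 1 - t by rewrite subr_ge0.
rewrite le_min; apply/andP; split.
- apply: le_trans (cf t x y t01 Dx Dy).
  by rewrite lerD// ler_wpM2l// ge_min lexx.
- apply: le_trans (cg t x y t01 Dx Dy).
  by rewrite lerD// ler_wpM2l// ge_min lexx orbT.
Qed.

Lemma concave_scale D f (c : R) : 0 <= c -> concave_function D f ->
  concave_function D (fun x => c * f x).
Proof.
move=> c0 /concave_functionP cf; apply/concave_functionP => t x y t01 Dx Dy.
by rewrite ![_ * (c * _)]mulrCA -mulrDr ler_wpM2l// cf.
Qed.

(** Average the two affine bounds based at the convex combination [z]: the slope terms cancel and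
    only [f z] remains. *)
Lemma concave_supergradient D f (s : R -> R) :
  (forall t x y, 0 <= t <= 1 -> D x -> D y -> D (t * x + (1 - t) * y)) ->
  (forall x y, D x -> D y -> f y <= f x + s x * (y - x)) ->
  concave_function D f.
Proof.
move=> cD fs; apply/concave_functionP => t x y t01 Dx Dy.
move: (t01) => /andP[t0 t1].
have Dz := cD t x y t01 Dx Dy; set z := t * x + (1 - t) * y in Dz *.
have h1 : t * f x <= t * (f z + s z * (x - z)) by rewrite ler_wpM2l// fs.
have h2 : (1 - t) * f y <= (1 - t) * (f z + s z * (y - z)).
  by rewrite ler_wpM2l ?subr_ge0// fs.
apply: le_trans (lerD h1 h2) _.
suff -> : t * (f z + s z * (x - z)) + (1 - t) * (f z + s z * (y - z)) = f z.
  by [].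
by rewrite /z; ring.
Qed.

Lemma convex_itv01 (t x y : R) :
  0 <= t <= 1 -> `]0, 1[%classic x -> `]0, 1[%classic y ->
  `]0, 1[%classic (t * x + (1 - t) * y).
Proof.
have pos (a b : R) : 0 <= t <= 1 -> 0 < a -> 0 < b -> 0 < t * a + (1 - t) * b.
  move=> /andP[t0 t1] a0 b0; have [->|tn0] := eqVneq t 0.
    by rewrite mul0r add0r subr0 mul1r.
  have t_gt0 : 0 < t by rewrite lt_neqAle eq_sym tn0.
  by rewrite ltr_pwDl ?mulr_gt0// mulr_ge0// ?subr_ge0// ltW.
rewrite /= !in_itv/= => t01 /andP[x0 x1] /andP[y0 y1].
(* The upper bound is positivity applied to [1 - x] and [1 - y]. *)
rewrite pos//=; have := pos (1 - x) (1 - y) t01; rewrite !subr_gt0.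
by move=> /(_ x1 y1); lra.
Qed.

End concave.

(** * Absolute continuity with respect to Lebesgue measure *)

Section absolute_continuity.
Context {R : realType}.
Notation lambda := (@lebesgue_measure R).

Lemma has_density_null (F : distr R) (A : set R) : has_density F ->
  measurable A -> lambda A = 0%E -> F A = 0%E.
Proof.
move=> [f [mf f0 fE]] mA A0; rewrite (fE _ mA).
apply: null_set_integral; [exact: mA| |exact: A0].
by apply/measurable_EFinP; apply: measurable_funTS; exact: mf.
Qed.

(** The Radon-Nikodym derivative is finite everywhere, so [fine] turns it into a real-valued
    density. *)
Lemma null_dominates_density (F : distr R) :
  (forall A : set R, measurable A -> lambda A = 0%E -> F A = 0%E) ->
  has_density F.
Proof.
move=> FA.
have Fl : F `<< lambda by apply/null_content_dominatesP => A mA; exact: FA.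
have [f [f0 ffin fint fE]] := @radon_nikodym_sigma_finite _ _ _ lambda F Fl.
have fineE x : (fine (f x))%:E = f x by rewrite fineK.
exists (fine \o f); split.
- apply/measurable_EFinP => /=.
  rewrite (_ : _ \o _ = f); last exact/funext.
  by case/integrableP : fint.
- by move=> x; rewrite fine_ge0.
- by move=> A mA; rewrite fE//; apply: eq_integral => x _ /=; rewrite fineE.
Qed.

(** A Lebesgue-null set is covered by open intervals of arbitrarily small total length, and
    countable subadditivity carries the bound from the intervals to the set. *)
Lemma null_of_itv_bound (nu : {measure set (measurableTypeR R) -> \bar R})
    (C : R) (A : set R) :
  0 <= C -> (forall a b, a < b -> (nu `]a, b[%classic <= (C * (b - a))%:E)%E) ->
  lambda A = 0%E -> measurable A -> nu A = 0%E.
Proof.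
move=> C0 nuC A0 mA.
apply/eqP; rewrite eq_le measure_ge0 andbT; apply/lee_addgt0Pr => e e0.
rewrite add0e.
(* The denominator [C + 1] also covers the case [C = 0]. *)
have Ce0 : 0 < e / (C + 1) by rewrite divr_gt0// ltr_wpDl.
have := outer_measure_open_itv_cover A.
rewrite -[X in X = _]/(lambda A) A0 => infE.
have : (ereal_inf [set \sum_(k <oo) wlength idfun (F k) | F in open_itv_cover A]
   \is a fin_num)%E by rewrite -infE.
move=> /lb_ereal_inf_adherent-/(_ _ Ce0)[_ [F [Fitv AF] <-]].
rewrite -infE add0e => /ltW Fe.
have mF i : measurable (F i).
  by have [[a b] ->] := Fitv i; exact: measurable_itv.
apply: (@le_trans _ _ (\sum_(k <oo) nu (F k))%E).
  by apply: measure_sigma_subadditive.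
apply: (@le_trans _ _ (\sum_(k <oo) (C%:E * wlength idfun (F k)))%E).
  apply: lee_nneseries => // i _; have [[a b] ->] := Fitv i.
  rewrite wlength_itv /= lte_fin; case: ltP => ab.
    by rewrite -EFinB -EFinM; exact: nuC.
  by rewrite mule0 set_itv_ge ?measure0// bnd_simp -leNgt.
rewrite nneseriesZl//.
apply: (@le_trans _ _ (C%:E * (e / (C + 1))%:E)%E).
  by apply: lee_wpmul2l => //; rewrite lee_fin.
rewrite -EFinM lee_fin mulrCA ger_pMr// ler_pdivrMr ?mul1r ?lerDl//.
by rewrite ltr_wpDl.
Qed.

End absolute_continuity.

(** * Cumulative distribution functions and upper tails *)

Section distribution_functions.
Context {R : realType}.
Implicit Types (F : distr R) (x y u : R).

Definition ccdf_ge F x : R := 1 - dcdf F x.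

Lemma dcdfE F x : F `]-oo, x]%classic = (dcdf F x)%:E.
Proof. by rewrite /dcdf fineK// fin_num_measure. Qed.

Lemma dcdf_ge0 F x : 0 <= dcdf F x.
Proof. by rewrite fine_ge0. Qed.

Lemma dcdf_le1 F x : dcdf F x <= 1.
Proof. by rewrite -lee_fin -dcdfE; exact: probability_le1. Qed.

Lemma dcdf_nd F x y : x <= y -> dcdf F x <= dcdf F y.
Proof.
move=> xy; rewrite -lee_fin -!dcdfE le_measure ?inE//.
by apply: subset_itvl; rewrite bnd_simp.
Qed.

Lemma dcdf_itvoc F x y : x <= y ->
  F `]x, y]%classic = (dcdf F y - dcdf F x)%:E.
Proof.
move=> xy; rewrite EFinB -!dcdfE.
have -> : `]-oo, y]%classic = `]-oo, x]%classic `|` `]x, y]%classic.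
  apply/seteqP; split => z /=; rewrite !in_itv/=.
    by move=> zy; case: (leP z x) => ?; [left|right].
  by case=> [/le_trans|/andP[]//]; exact.
rewrite measureU//; last first.
  apply/seteqP; split => z //=; rewrite !in_itv/= => -[zx /andP[]].
  by rewrite ltNge zx.
by rewrite addeAC subee ?add0e// fin_num_measure.
Qed.

Lemma ccdf_ge_ni F x y : x <= y -> ccdf_ge F y <= ccdf_ge F x.
Proof. by move=> xy; rewrite lerB// dcdf_nd. Qed.

Lemma dcdf_itvoy F x : F `]x, +oo[%classic = (ccdf_ge F x)%:E.
Proof.
rewrite /ccdf_ge EFinB -dcdfE -probability_setC//.
by congr (F _); rewrite setCitvl.
Qed.

Lemma dcdf_cvg0 F e : 0 < e -> exists x, dcdf F x < e.
Proof.
(* The identity is a random variable with law [F], so limits of the CDF of a random variable apply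
   to [dcdf F]. *)
move=> e0; have mid : @measurable_fun _ _ (measurableTypeR R) R setT idfun.
  exact: measurable_id.
pose X : {mfun measurableTypeR R >-> R} :=
  @mfun_Sub _ _ (measurableTypeR R) R _ (mem_set mid).
have /fine_cvg := @cvg_cdfNy0 _ _ _ F X.
move=> /cvgr_lt/(_ _ e0)[M [_ ]] /(_ (M - 1)) h.
by exists (M - 1); apply: h; rewrite gtrBl.
Qed.

Lemma dcdf_cvg1 F u : u < 1 -> exists x, u < dcdf F x.
Proof.
move=> u1; have mid : @measurable_fun _ _ (measurableTypeR R) R setT idfun.
  exact: measurable_id.
pose X : {mfun measurableTypeR R >-> R} :=
  @mfun_Sub _ _ (measurableTypeR R) R _ (mem_set mid).
have /fine_cvg := @cvg_cdfy1 _ _ _ F X.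
move=> /cvgr_gt/(_ _ u1)[M [_ ]] /(_ (M + 1)) h.
by exists (M + 1); apply: h; rewrite ltrDl.
Qed.

(** The integral of an integrable density over []y, z]] is small as soon as [z - y] is. *)
Lemma has_density_continuous F : has_density F -> continuous (dcdf F).
Proof.
move=> [f [mf f0 fE]] x.
have intf : (@lebesgue_measure R).-integrable setT (EFin \o f).
  apply/integrableP; split; first exact/measurable_EFinP.
  under eq_integral do rewrite /= ger0_norm//.
  have := fE setT measurableT; rewrite probability_setT => <-.
  by rewrite ltry.
have bnd y z e d : y <= z -> z - y < d ->
    (forall A, measurable A -> (lebesgue_measure A < d%:E)%E ->
       \int[lebesgue_measure]_(x in A) `|f x| < e) ->
    dcdf F z - dcdf F y < e.
  move=> yz zyd h; have := h `]y, z]%classic.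
  rewrite lebesgue_measure_itv/= lte_fin.
  have -> : dcdf F z - dcdf F y =
      \int[lebesgue_measure]_(x in `]y, z]%classic) `|f x|.
    rewrite /Rintegral; under eq_integral do rewrite ger0_norm//.
    by rewrite -fE// dcdf_itvoc.
  apply => //; case: ifPn => [_|]; first by rewrite -EFinB lte_fin.
  by rewrite lte_fin -leNgt => zy; rewrite (le_lt_trans _ zyd)// subr_ge0.
apply/cvgrPdist_lt => e e0.
have [d [d0 h]] := integral_normr_continuous intf e0.
exists d => //= z /= xzd.
case: (leP x z) => xz.
- rewrite distrC ger0_norm ?subr_ge0 ?dcdf_nd//.
  by apply: bnd h; rewrite // -(ger0_norm (_ : 0 <= z - x)) ?subr_ge0// distrC.
- rewrite ger0_norm ?subr_ge0 ?dcdf_nd ?ltW//.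
  by apply: bnd h; rewrite ?ltW// -(gtr0_norm (_ : 0 < x - z)) ?subr_gt0.
Qed.

End distribution_functions.

(** * Atomless distributions and their quantiles *)

Section continuous_distribution.
Context {R : realType} (F : distr R) (hF : has_density F).
Implicit Types (x y u : R).

Let cF x : dcdf F y @[y --> x] --> dcdf F x.
Proof. exact: has_density_continuous. Qed.

Lemma density_set1 x : F [set x] = 0%E.
Proof. by apply: (has_density_null hF) => //; exact: lebesgue_measure_set1. Qed.

Lemma ccdf_itvcy x : F `[x, +oo[%classic = (ccdf_ge F x)%:E.
Proof.
rewrite -(@setU1itv _ _ _ x false) ?bnd_simp// measureU//; last first.
  by apply/seteqP; split => z //= -[->]; rewrite in_itv/= ltxx.
rewrite -[RHS]add0e; exact: congr2 (density_set1 x) (dcdf_itvoy F x).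
Qed.

Lemma ccdf_itvco x y : x <= y ->
  F `[x, y[%classic = (ccdf_ge F x - ccdf_ge F y)%:E.
Proof.
move=> xy; rewrite EFinB -!ccdf_itvcy.
have -> : `[x, +oo[%classic = `[x, y[%classic `|` `[y, +oo[%classic.
  apply/seteqP; split => z /=; rewrite !in_itv/= ?andbT.
    by move=> xz; case: (leP y z) => ?; [right|left; rewrite xz].
  by case=> [/andP[]//|]; exact: le_trans.
rewrite measureU//; last first.
  apply/seteqP; split => z //=; rewrite !in_itv/= => -[/andP[_ zy]].
  by rewrite leNgt zy.
by rewrite addeK// fin_num_measure.
Qed.

Lemma quantile_lt u y : 0 < u < 1 -> y < quantile F u -> dcdf F y < u.
Proof.
move=> /andP[u0 u1] yQ; rewrite ltNge; apply/negP => uy.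
move: yQ; rewrite ltNge => /negP; apply; apply: ge_inf => //.
have [z zu] := dcdf_cvg0 F u0; exists z => t /= ut.
rewrite leNgt; apply/negP => /ltW/(dcdf_nd F) tz.
by have := le_lt_trans (le_trans ut tz) zu; rewrite ltxx.
Qed.

(** Continuity excludes a jump over [u]. A CDF above [u] at the quantile would stay above [u]
    slightly to its left, against [quantile_lt]; a CDF below [u] would stay below on a right
    neighbourhood, which must contain points of the level set. *)
Lemma dcdf_quantile u : 0 < u < 1 -> dcdf F (quantile F u) = u.
Proof.
move=> u01; move: (u01) => /andP[u0 u1]; set q := quantile F u.
have ne : [set x | u <= dcdf F x] !=set0.
  by have [z /ltW zu] := dcdf_cvg1 F u1; exists z.
apply/eqP; rewrite eq_le; apply/andP; split; rewrite leNgt; apply/negP => h.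
- have /cvgr_gt/(_ _ h) := @cF q.
  move=> -[e /= e0] /(_ (q - e / 2)) /=.
  rewrite opprB addrC subrK ger0_norm ?ltW ?divr_gt0//.
  rewrite ltr_pdivrMr// ltr_pMr// ltrDl ltr01 => /(_ isT).
  apply/negP; rewrite -leNgt ltW// quantile_lt// gtrBl divr_gt0//.
- have /cvgr_lt/(_ _ h) := @cF q.
  move=> -[e /= e0] qe.
  have : q < q + e by rewrite ltrDl.
  move=> /(inf_lt ne)[y /= uy yqe].
  have qy : q <= y by apply: contra_le uy => yq; exact: quantile_lt.
  have := qe y; rewrite /= distrC ger0_norm ?subr_ge0// ltrBlDl => /(_ yqe).
  by rewrite ltNge uy.
Qed.

Lemma ccdf_ge_continuous : continuous (ccdf_ge F).
Proof. by move=> x; apply: cvgB; [exact: cvg_cst|exact: cF]. Qed.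

Lemma ccdf_quantile q : 0 < q < 1 -> ccdf_ge F (quantile F (1 - q)) = q.
Proof.
move=> /andP[q0 q1]; rewrite /ccdf_ge dcdf_quantile ?subKr//.
by rewrite subr_gt0 q1 gtrBl.
Qed.

Lemma ccdf_itvcc x y : x <= y ->
  F `[x, y]%classic = (ccdf_ge F x - ccdf_ge F y)%:E.
Proof.
move=> xy.
have -> : `[x, y]%classic = [set x] `|` `]x, y]%classic.
  by rewrite (@setU1itv _ _ _ x false)// bnd_simp.
rewrite measureU//; last first.
  by apply/seteqP; split => z //= -[->]; rewrite in_itv/= ltxx.
apply: (@etrans _ _ (0 + (dcdf F y - dcdf F x)%:E)%E).
  exact: congr2 (density_set1 x) (dcdf_itvoc F xy).
by rewrite add0e; congr EFin; rewrite /ccdf_ge; lra.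
Qed.

End continuous_distribution.

(** * The support of a distribution *)

Section support.
Context {R : realType} (F : distr R) (hF : has_density F).
Implicit Types (x y u : R).

(** The CDF is strictly below [u] to the left of the quantile and equals [u] there, so every left
    neighbourhood carries mass. *)
Lemma quantile_supp u : 0 < u < 1 -> supp F (quantile F u).
Proof.
move=> u01 U oU Uq.
have := open_nbhs_nbhs (conj oU Uq) => /nbhs_ballP[e /= e0 eU].
set q := quantile F u in Uq eU *.
have qe : q - e / 2 < q by rewrite gtrBl divr_gt0.
have : (0 < F `](q - e / 2)%R, q]%classic)%E.
  by rewrite dcdf_itvoc ?ltW// lte_fin subr_gt0 dcdf_quantile// quantile_lt.
move=> /lt_le_trans; apply.
rewrite le_measure ?inE//; first exact: open_measurable.
move=> z /=; rewrite in_itv/= => /andP[z1 z2]; apply: eU.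
rewrite /ball/= ger0_norm ?subr_ge0//; lra.
Qed.

(** A point outside the support lies in a null open set, hence in a null interval with rational
    endpoints; there are countably many of these. *)
Lemma supp_negligible : F.-negligible (~` supp F).
Proof.
pose J (qr : rat * rat) : set R := `]ratr qr.1, ratr qr.2[%classic.
pose N n : set R := if unpickle n is Some qr then
   if F (J qr) == 0%E then J qr else set0 else set0.
apply: (@negligibleS _ _ _ F (\bigcup_n N n)); last first.
  apply: negligible_bigcup => n; rewrite /N.
  case: unpickle => [qr|]; last exact: negligible_set0.
  case: eqP => [J0|_]; last exact: negligible_set0.
  by apply/negligibleP => //; exact: measurable_itv.
move=> x /=; rewrite /supp /= -existsNE => -[U].
move=> /not_implyP[oU] /not_implyP[Ux U0].
have := open_nbhs_nbhs (conj oU Ux) => /nbhs_ballP[e /= e0 eU].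
have xe1 : x - e < x by rewrite gtrBl.
have xe2 : x < x + e by rewrite ltrDl.
have [q /[!in_itv]/= /andP[q1 q2]] := rat_in_itvoo xe1.
have [r /[!in_itv]/= /andP[r1 r2]] := rat_in_itvoo xe2.
exists (pickle (q, r)); first exact: I.
rewrite /N pickleK.
have -> : F (J (q, r)) = 0%E.
  apply/eqP; rewrite eq_le measure_ge0 andbT.
  have -> : 0%E = F U.
    by apply/eqP; rewrite eq_le measure_ge0/= leNgt; exact/negP.
  rewrite le_measure ?inE//; [exact: measurable_itv|exact: open_measurable|].
  move=> z; rewrite /J /= in_itv/= => /andP[z1 z2]; apply: eU.
  by rewrite /ball/= ltr_distlC; apply/andP; split; lra.
have Jx : J (q, r) x by rewrite /J /= in_itv/= q2 r1.
by rewrite eqxx; exact: Jx.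
Qed.

(** If the CDF were [c > 0] at the origin, continuity would make it exceed [c / 2] at some negative
    point, so the [c / 2]-quantile would be a negative point of the support. *)
Lemma dcdf_neg0 : supp F `<=` [set x | 0 <= x] -> dcdf F 0 = 0.
Proof.
move=> sF; apply/eqP; rewrite eq_le dcdf_ge0 andbT leNgt; apply/negP => c0.
set c := dcdf F 0 in c0.
have c1 : c <= 1 := dcdf_le1 F 0.
have cc : c / 2 < c by rewrite ltr_pdivrMr// ltr_pMr// ltrDl ltr01.
have := @has_density_continuous _ _ hF 0 => /cvgr_gt/(_ _ cc).
move=> [e /= e0] /(_ (- (e / 2))) /=.
rewrite sub0r opprK ger0_norm ?divr_ge0 ?ltW// => h.
have {}h : c / 2 < dcdf F (- (e / 2)) by apply: h; lra.
have c01 : 0 < c / 2 < 1 by apply/andP; split; lra.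
have /sF /= q0 := quantile_supp c01.
have : - (e / 2) < quantile F (c / 2) by lra.
by move=> /(quantile_lt c01); rewrite ltNge ltW.
Qed.

End support.

(** * Regularity of the image of a distribution under a monotone map *)

Section pushforward_distribution.
Context {R : realType} (F : distr R) (T : R -> R).
Hypothesis hF : valuation_distr F.
Hypothesis T_nd : {homo T : x y / x <= y}.

Let mT : @measurable_fun _ _ (measurableTypeR R) (measurableTypeR R) setT T.
Proof. exact: nondecreasing_measurable. Qed.

(** The null-preimage hypothesis gives the image law a density. The hypothesis producing some
    [y < x] is left continuity of the monotone [T]; it makes quantiles commute with [T], so the
    concave function of the last hypothesis is the revenue curve of the image. *)
Lemma pushforward_regular :
  (forall x, 0 <= x -> 0 <= T x) ->
  (forall A : set R, measurable A ->
     lebesgue_measure A = 0%E -> F (T @^-1` A) = 0%E) ->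
  (forall x p, 0 < ccdf_ge F x -> p < T x -> exists2 y, y < x & p < T y) ->
  concave_function `]0, 1[%classic (fun q => q * T (quantile F (1 - q))) ->
  exists G : distr R, [/\ valuation_distr G, regular G &
    forall p, standard_purchase_prob G p = F [set x | p <= T x]].
Proof.
move=> T0 TA Tl Tc; have [_ dF sF] := hF.
pose X : {mfun measurableTypeR R >-> measurableTypeR R} :=
  @mfun_Sub _ _ (measurableTypeR R) (measurableTypeR R) T (mem_set mT).
pose G : distr R := distribution F X; exists G.
have dG : has_density G by apply: null_dominates_density => A mA; exact: TA.
have dcdfG p : dcdf G p = fine (F [set x | T x <= p]) by [].
have mle p : measurable [set x | T x <= p].
  rewrite (_ : [set _ | _] = T @^-1` `]-oo, p]%classic).
    by rewrite -[X in measurable X]setTI; exact: mT.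
  by apply/seteqP; split => z /=; rewrite in_itv.
split => //.
- split => //; first exact: has_density_continuous.
  move=> z /= sz; rewrite leNgt; apply/negP => z0.
  have oz : open (`]-oo, 0[%classic : set R) by exact: interval_open.
  have := sz _ oz; rewrite /= in_itv/= => /(_ z0).
  suff -> : G `]-oo, 0[%classic = 0%E by rewrite ltxx.
  apply/eqP; rewrite eq_le measure_ge0 andbT.
  (* As [T] is nonnegative on nonnegative values, [T x < 0] forces [x < 0], an event of
     [F]-probability zero. *)
  have -> : 0%E = F `]-oo, 0]%classic by rewrite dcdfE (dcdf_neg0 dF).
  apply: (@le_measure _ _ _ F); rewrite ?inE//.
    by rewrite -[X in measurable X]setTI; exact: mT.
  move=> x /=; rewrite !in_itv/=; apply: contraTT.
  by rewrite -leNgt -ltNge => /ltW; exact: T0.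
- have QG u : 0 < u < 1 -> quantile G u = T (quantile F u).
    move=> u01; set x := quantile F u.
    have Fx : dcdf F x = u := dcdf_quantile dF u01.
    have Sx : 0 < ccdf_ge F x by rewrite subr_gt0 Fx; case/andP : u01.
    have GT : u <= dcdf G (T x).
      rewrite -Fx -lee_fin -[leLHS]dcdfE dcdfG fineK;
        last by apply: fin_num_measure; exact: mle.
      apply: (@le_measure _ _ _ F); rewrite ?inE;
        [exact: measurable_itv|exact: mle|].
      by move=> y /=; rewrite in_itv/=; exact: T_nd.
    (* Left continuity gives [y < x] with [p < T y], so [T z <= p] forces [z <= y], and the CDF of
       [F] at [y] is below [u]. *)
    have Glt p : p < T x -> dcdf G p < u.
      move=> /(Tl _ _ Sx)[y yx py]; apply: le_lt_trans (quantile_lt u01 yx).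
      rewrite -lee_fin -[leRHS]dcdfE dcdfG fineK;
        last by apply: fin_num_measure; exact: mle.
      apply: (@le_measure _ _ _ F); rewrite ?inE;
        [exact: mle|exact: measurable_itv|].
      move=> z /=; rewrite in_itv/= => Tzp; rewrite leNgt; apply/negP => yz.
      by have := lt_le_trans py (le_trans (T_nd (ltW yz)) Tzp); rewrite ltxx.
    have lb : lbound [set p | u <= dcdf G p] (T x).
      by move=> p /=; apply: contra_le; exact: Glt.
    apply/eqP; rewrite eq_le; apply/andP; split.
      by apply: ge_inf => //; exists (T x).
    by apply: lb_le_inf => //; exists (T x).
  apply: eq_concave_function Tc; first exact: convex_itv01.
  move=> q /[!inE]/= /[!in_itv]/= /andP[q0 q1].
  by rewrite /revenue_curve QG// subr_gt0 q1 gtrBl.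
Qed.

End pushforward_distribution.

(** * Tail expectations under a finite mean *)

Section tail_expectation.
Context {R : realType} (F : distr R) (hF : has_density F).
Hypothesis intF : F.-integrable setT (EFin : measurableTypeR R -> \bar R).
Implicit Types (x y u : R).
Let S := ccdf_ge F.

Definition tail_int x : R := fine (\int[F]_(v in `[x, +oo[%classic) v%:E).

Let intF_sub (A : set (measurableTypeR R)) : measurable A ->
  F.-integrable A (EFin : measurableTypeR R -> \bar R).
Proof. by move=> mA; apply: integrableS intF. Qed.

Lemma tail_intE x : (\int[F]_(v in `[x, +oo[%classic) v%:E)%E = (tail_int x)%:E.
Proof.
rewrite fineK//; apply: integrable_fin_num; first exact: measurable_itv.
by apply: intF_sub; exact: measurable_itv.
Qed.

Let tail_int_split x y : x <= y ->
  (\int[F]_(v in `[x, y[%classic) v%:E)%E = (tail_int x - tail_int y)%:E.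
Proof.
move=> xy; rewrite EFinB -!tail_intE.
have -> : `[x, +oo[%classic = `[x, y[%classic `|` `[y, +oo[%classic.
  apply/seteqP; split => z /=; rewrite !in_itv/= ?andbT.
    by move=> xz; case: (leP y z) => ?; [right|left; rewrite xz].
  by case=> [/andP[]//|]; exact: le_trans.
rewrite integral_setU//=; last first.
  apply/disj_setPS => z /=; rewrite !in_itv/= => -[/andP[_ zy]].
  by rewrite leNgt zy.
by rewrite addeK// tail_intE.
Qed.

Let tail_int_bounds x y : x <= y ->
  x * (S x - S y) <= tail_int x - tail_int y <= y * (S x - S y).
Proof.
move=> xy; rewrite -!lee_fin -tail_int_split// !EFinM -(ccdf_itvco hF)//.
have mxy : measurable (`[x, y[%classic : set (measurableTypeR R)).
  exact: measurable_itv.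
rewrite -!(integral_cst F mxy); apply/andP; split; apply: le_integral => //=.
- exact: finite_measure_integrable_cst.
- exact: intF_sub.
- by move=> z /[!inE]/= /[!in_itv]/= /andP[? _]; rewrite lee_fin.
- exact: intF_sub.
- exact: finite_measure_integrable_cst.
- by move=> z /[!inE]/= /[!in_itv]/= /andP[_ /ltW]; rewrite lee_fin.
Qed.

(* In quantile space this says that [Q (1 - q)] is a supergradient at [q] of the
   integrated quantile function [q |-> tail_int (Q (1 - q))]. *)
Lemma tail_int_supergradient x y :
  tail_int x - tail_int y <= y * (S x - S y).
Proof.
case: (leP x y) => [/tail_int_bounds/andP[]//|/ltW/tail_int_bounds/andP[+ _]].
by rewrite -lerN2 opprB -mulrN opprB.
Qed.

Lemma tail_int_ge x : x * S x <= tail_int x.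
Proof.
have mx : measurable (`[x, +oo[%classic : set (measurableTypeR R)).
  exact: measurable_itv.
rewrite -lee_fin EFinM -tail_intE -(ccdf_itvcy hF) -(integral_cst F mx).
apply: le_integral => //=.
- exact: finite_measure_integrable_cst.
- exact: intF_sub.
- by move=> z /[!inE]/= /[!in_itv]/= /[!andbT]; rewrite lee_fin.
Qed.

Lemma tail_int_eq0 x : S x = 0 -> tail_int x = 0.
Proof.
move=> Sx0; rewrite /tail_int null_set_integral//=.
by rewrite (ccdf_itvcy hF) -/S Sx0.
Qed.

(* Where the tail probability vanishes, [x] bounds the support from above, so
   this value keeps [cond_mean] nondecreasing on the whole line. *)
Definition cond_mean x : R := if 0 < S x then tail_int x / S x else x.

Let S_ge0 x : 0 <= S x. Proof. by rewrite subr_ge0 dcdf_le1. Qed.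
Let S_le1 x : S x <= 1. Proof. by rewrite gerBl dcdf_ge0. Qed.
Let S_ni x y : x <= y -> S y <= S x. Proof. exact: ccdf_ge_ni. Qed.
Let cS x : S y @[y --> x] --> S x.
Proof. exact: (ccdf_ge_continuous hF). Qed.

Lemma cond_mean_tail_int x : S x * cond_mean x = tail_int x.
Proof.
rewrite /cond_mean; case: ifPn => [S0|]; first by rewrite mulrC divfK ?gt_eqF.
rewrite -leNgt => Sx; have S0 : S x = 0 by apply/eqP; rewrite eq_le Sx S_ge0.
by rewrite S0 mul0r tail_int_eq0.
Qed.

Lemma cond_mean_ge x : x <= cond_mean x.
Proof.
by rewrite /cond_mean; case: ifPn => // S0; rewrite ler_pdivlMr// tail_int_ge.
Qed.

(** The tail mean at [x] averages the tail mean at [y] with values in [[x, y[], and these lie below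
    [y], hence below the tail mean at [y]. *)
Lemma cond_mean_nd : {homo cond_mean : x y / x <= y}.
Proof.
move=> x y xy; have [Sy|Sy] := ltP 0 (S y).
  have Sx := lt_le_trans Sy (S_ni xy).
  have := tail_int_supergradient x y; have := cond_mean_ge y.
  rewrite -!cond_mean_tail_int => wy K; rewrite -(ler_pM2l Sx).
  have := S_ni xy; nra.
have Sy0 : S y = 0 by apply/eqP; rewrite eq_le Sy S_ge0.
rewrite [leRHS]/cond_mean ltNge Sy/=.
rewrite /cond_mean; case: ifPn => [S0|//]; rewrite ler_pdivrMr//.
have := tail_int_supergradient x y.
by rewrite Sy0 (tail_int_eq0 Sy0) !subr0.
Qed.

Lemma cond_mean_left x p : 0 < S x -> p < cond_mean x ->
  exists2 y, y < x & p < cond_mean y.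
Proof.
move=> Sx px.
(* For [x - 1 <= y <= x], the supergradient inequality makes [h y] a lower bound of
   [tail_int y - p * S y]. With the constant slope [x - 1] in place of [y], continuity of [h]
   follows from that of [S] alone. *)
pose h y := tail_int x + (x - 1) * (S y - S x) - p * S y.
have ch : h y @[y --> x] --> h x.
  apply: cvgB; last by apply: cvgMr; exact: cS.
  apply: cvgD; first exact: cvg_cst.
  by apply: cvgMr; apply: cvgB; [exact: cS|exact: cvg_cst].
have hx : 0 < h x.
  rewrite /h subrr mulr0 addr0 subr_gt0 -cond_mean_tail_int mulrC.
  by rewrite ltr_pM2l.
move/cvgr_gt : ch => /(_ _ hx)[e /= e0 he].
pose d := Num.min e 1 / 2.
have m0 : 0 < Num.min e 1 by rewrite lt_min e0 ltr01.
have d0 : 0 < d by rewrite divr_gt0.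
have de : d < Num.min e 1 by rewrite ltr_pdivrMr// ltr_pMr// ltrDl ltr01.
move: de; rewrite lt_min => /andP[de d1].
exists (x - d); first by rewrite gtrBl.
have := he (x - d); rewrite /= opprB addrC subrK gtr0_norm// => /(_ de).
have xd : x - d <= x by rewrite gerBl ltW.
have Sy := lt_le_trans Sx (S_ni xd).
rewrite /h => hy; rewrite -(ltr_pM2l Sy) cond_mean_tail_int mulrC.
have := tail_int_supergradient x (x - d); have := S_ni xd.
nra.
Qed.

(* [cond_mean] expands distances measured by [F]: this lower Lipschitz bound makes
   the law of [cond_mean v] absolutely continuous. *)
Lemma ccdf_ge_cond_mean x1 x2 y : x1 <= x2 -> x2 <= y ->
  (S x1 - S x2) * (tail_int y - y * S y) <= cond_mean x2 - cond_mean x1.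
Proof.
move=> x12 x2y.
have wx2 := cond_mean_ge x2; have w12 := cond_mean_nd x12.
have S12 := S_ni x12.
(* Both sides are expected excesses, of [v] over [y] and over [x2]; the excess decreases with the
   level, so one constant taken at [y] serves all points below [y]. *)
have D : tail_int y - y * S y <= tail_int x2 - x2 * S x2.
  have := tail_int_supergradient y x2; have := S_ge0 y; nra.
have K := tail_int_supergradient x1 x2.
apply: (@le_trans _ _ ((S x1 - S x2) * (tail_int x2 - x2 * S x2))).
  by rewrite ler_wpM2l// subr_ge0.
rewrite -!cond_mean_tail_int in K *.
apply: (@le_trans _ _ ((S x1 - S x2) * (cond_mean x2 - x2))).
  rewrite ler_wpM2l ?subr_ge0//.
  have := S_le1 x2; nra.
apply: (@le_trans _ _ (S x1 * (cond_mean x2 - cond_mean x1))).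
  by nra.
by rewrite ler_piMl// subr_ge0.
Qed.

(** The expected excess of [v] over [y] is at least [(z - y) * S z]. *)
Lemma tail_int_gt y z : y < z -> 0 < S z -> 0 < tail_int y - y * S y.
Proof.
move=> yz Sz.
have := tail_int_supergradient z y; have := tail_int_ge z.
nra.
Qed.

Lemma concave_tail_int :
  concave_function `]0, 1[%classic (fun q => tail_int (quantile F (1 - q))).
Proof.
apply: (concave_supergradient (s := fun q => quantile F (1 - q))).
  exact: convex_itv01.
move=> x y /=; rewrite !in_itv/= => x01 y01.
have := tail_int_supergradient (quantile F (1 - y)) (quantile F (1 - x)).
by rewrite /S !(ccdf_quantile hF)// lerBlDl.
Qed.

End tail_expectation.

(** * Null sets and closed sets of reals *)

Section null_preimages.
Context {R : realType}.
Notation lambda := (@lebesgue_measure R).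

Lemma eq_measure_negligible d (T : measurableType d)
    (mu : {measure set T -> \bar R}) (A B N : set T) :
  measurable A -> measurable B -> mu.-negligible N ->
  (forall x, ~ N x -> A x <-> B x) -> mu A = mu B.
Proof.
move=> mA mB [M [mM M0 NM]] AB.
rewrite -(measureU0 mA mM M0) -(measureU0 mB mM M0); congr (mu _).
by apply/seteqP; split => x [ABx|Mx]; [|right| |right] => //;
  have [/NM|/AB ABx'] := pselect (N x);
  [right|left; exact/ABx'|right|left; exact/ABx'].
Qed.

Lemma closed_sup (C E : set R) : closed C -> E `<=` C -> E !=set0 ->
  has_ubound E -> C (sup E).
Proof. by move=> cC EC E0 uE; apply/cC/(closure_subset EC)/closure_sup. Qed.

Lemma closed_inf (C E : set R) : closed C -> E `<=` C -> E !=set0 ->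
  has_lbound E -> C (inf E).
Proof.
move=> cC EC [x Ex] lE.
apply: (@closed_sup (-%R @^-1` C) (-%R @` E)).
- by apply: preimage_closed => // z _; exact: continuousN.
- by move=> _ [z Ez <-] /=; rewrite opprK; exact: EC.
- by exists (- x), x.
- exact/has_lb_ubN.
Qed.

(** The image of Lebesgue measure under multiplication by [c] gives an interval its length divided
    by [c], so [null_of_itv_bound] applies. *)
Lemma lebesgue_null_scale (c : R) (A : set R) : 0 < c -> measurable A ->
  lambda A = 0%E -> lambda [set x | A (c * x)] = 0%E.
Proof.
move=> c0 mA A0.
have mc : @measurable_fun _ _ (measurableTypeR R) (measurableTypeR R) setT
    ( *%R c).
  exact: mulrl_measurable.
pose X : {mfun measurableTypeR R >-> measurableTypeR R} :=
  @mfun_Sub _ _ (measurableTypeR R) (measurableTypeR R) _ (mem_set mc).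
apply: (@null_of_itv_bound _ (pushforward lambda X) c^-1 A) => //.
  by rewrite invr_ge0 ltW.
move=> a b ab.
apply: (@le_trans _ _ (lambda `]c^-1 * a, c^-1 * b[%classic)).
  rewrite le_eqVlt; apply/orP; left; apply/eqP; congr (lambda _).
  by apply/seteqP; split => z /=; rewrite !in_itv/= ltr_pdivrMl// ltr_pdivlMl.
rewrite lebesgue_measure_itv/= lte_fin ltr_pM2l ?invr_gt0// ab.
by rewrite -EFinB mulrBr.
Qed.

End null_preimages.

(** * Absolute continuity of the law of the tail mean *)

Section density_ccdf.
Context {R : realType} (F : distr R) (hF : has_density F).
Let S := ccdf_ge F.

(** By continuity of [S] the set contains its infimum, and the tail from there has mass
    [S (inf N) = 0]. *)
Lemma ccdf_eq0_negligible : F.-negligible [set x | S x <= 0].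
Proof.
set N := [set x | _].
have [->|/set0P N0] := eqVneq N set0; first exact: negligible_set0.
have lN : has_lbound N.
  have [y y0] := @dcdf_cvg0 _ F 1 ltr01.
  exists y => x /= Sx; rewrite leNgt; apply/negP => /ltW/(dcdf_nd F).
  by move: Sx; rewrite /N /S /ccdf_ge /=; lra.
have SN : S (inf N) <= 0.
  apply: (@closed_inf _ [set x | S x <= 0] N) => //.
  apply: (@preimage_closed _ _ S [set x | x <= 0]); last exact: closed_le.
  by move=> x _; exact: (ccdf_ge_continuous hF).
exists `[inf N, +oo[%classic; split; first exact: measurable_itv.
  rewrite (ccdf_itvcy hF); congr EFin; apply/eqP.
  by rewrite eq_le SN subr_ge0 dcdf_le1.
by move=> x Nx /=; rewrite in_itv/= andbT ge_inf.
Qed.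

Hypothesis sF : supp F `<=` [set x | 0 <= x].

Lemma neg_negligible : F.-negligible [set x | x < 0].
Proof.
exists `]-oo, 0]%classic; split; first exact: measurable_itv.
  by rewrite dcdfE (dcdf_neg0 hF).
by move=> x /= x0; rewrite in_itv/= ltW.
Qed.

Hypothesis intF : F.-integrable setT (EFin : measurableTypeR R -> \bar R).
Let w := cond_mean F.

Let mw : @measurable_fun _ _ (measurableTypeR R) (measurableTypeR R) setT w.
Proof. by apply: nondecreasing_measurable => // x y; exact: cond_mean_nd. Qed.

(** On [[0, y]], [ccdf_ge_cond_mean] bounds the mass that the law of [w] gives to []a, b[] by
    [(b - a) / c], where [c] is the expected excess over [y]. The point [z] ensures [c > 0]; the
    bound degenerates at the top of the support, hence the restriction. *)
Let cond_mean_null_itv (y z : R) (A : set R) : y < z -> 0 < S z ->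
  measurable A -> lebesgue_measure A = 0%E ->
  F (w @^-1` A `&` `[0, y]%classic) = 0%E.
Proof.
move=> yz Sz mA A0.
pose X : {mfun measurableTypeR R >-> measurableTypeR R} :=
  @mfun_Sub _ _ (measurableTypeR R) (measurableTypeR R) _ (mem_set mw).
have m0y : measurable (`[0, y]%classic : set (measurableTypeR R)).
  exact: measurable_itv.
set c := tail_int F y - y * S y.
have c0 : 0 < c := tail_int_gt hF intF yz Sz.
apply: (@null_of_itv_bound _ (pushforward (mrestr F m0y) X) c^-1 A) => //.
  by rewrite invr_ge0 ltW.
move=> a b ab.
pose E : set R := w @^-1` `]a, b[%classic `&` `[0, y]%classic.
pose K := c^-1 * (b - a); change (F E <= K%:E)%E.
have K0 : 0 < K by apply: mulr_gt0; [rewrite invr_gt0|rewrite subr_gt0].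
have [->|/set0P E0] := eqVneq E set0; first by rewrite measure0 lee_fin ltW.
have EK x1 x2 : E x1 -> E x2 -> S x1 - S x2 <= K.
  move=> [/= + _] [/= + /itvP x2y].
  rewrite !in_itv/= => /andP[ax1 _] /andP[_ x2b].
  case: (leP x1 x2) => x12.
    rewrite /K ler_pdivlMl// mulrC.
    have := ccdf_ge_cond_mean hF intF x12 (_ : x2 <= y); rewrite x2y => /(_ isT).
    move=> /le_trans; apply; rewrite -/w.
    by move: ax1 x2b; rewrite -/w; lra.
  by apply: le_trans (ltW K0); rewrite subr_le0 ccdf_ge_ni// ltW.
have uE : has_ubound E by exists y => x [_ /=]; rewrite in_itv/= => /andP[].
have lE : has_lbound E by exists 0 => x [_ /=]; rewrite in_itv/= => /andP[].
(* The supremum and infimum of [E] may lie outside [E]; the bound reaches them, one at a time,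
   because [S] is continuous. *)
have ES x1 : E x1 -> S x1 - S (sup E) <= K.
  move=> Ex1; rewrite lerBlDr -lerBlDl.
  apply: (@closed_sup _ (S @^-1` [set u | S x1 - K <= u])) => //.
    by apply: preimage_closed (@closed_ge _ _) => t _;
      exact: (ccdf_ge_continuous hF).
  by move=> t Et /=; rewrite lerBlDl -lerBlDr EK.
have EI : S (inf E) - S (sup E) <= K.
  rewrite lerBlDr.
  apply: (@closed_inf _ (S @^-1` [set u | u <= K + S (sup E)])) => //.
    by apply: preimage_closed (@closed_le _ _) => t _;
      exact: (ccdf_ge_continuous hF).
  by move=> t Et /=; rewrite -lerBlDr ES.
have infsup : inf E <= sup E.
  by have [t Et] := E0; rewrite (le_trans (ge_inf lE Et))// ub_le_sup.
apply: (@le_trans _ _ (S (inf E) - S (sup E))%:E); last by rewrite lee_fin.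
rewrite -(ccdf_itvcc hF infsup).
apply: (@le_measure _ _ _ F); rewrite ?inE.
- apply: measurableI m0y.
  by rewrite -[X in measurable X]setTI; apply: mw => //; exact: measurable_itv.
- exact: measurable_itv.
- by move=> t Et /=; rewrite in_itv/= ge_inf// ub_le_sup.
Qed.

Lemma cond_mean_null (A : set R) :
  measurable A -> lebesgue_measure A = 0%E -> F (w @^-1` A) = 0%E.
Proof.
(* The shift by two keeps [q n] strictly below 1. The quantiles [y n] increase strictly and exhaust
   the points of positive tail, and [y n.+1] is the point beyond [y n] that the interval case asks
   for. *)
move=> mA A0; pose q n : R := n.+2%:R^-1.
have q01 n : 0 < q n < 1 by rewrite invr_gt0 ltr0n/= invf_lt1 ?ltr0n// ltr1n.
pose y n := quantile F (1 - q n).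
have Sy n : S (y n) = q n by exact: (ccdf_quantile hF).
have yS n : y n < y n.+1.
  rewrite ltNge; apply/negP => /(ccdf_ge_ni F).
  by rewrite -/S !Sy /q lef_pV2 ?posrE ?ltr0n// ler_nat ltnn.
have mwA : measurable (w @^-1` A : set (measurableTypeR R)).
  by rewrite -[X in measurable X]setTI; exact: mw.
apply/negligibleP => //.
apply: (@negligibleS _ _ _ F ([set x | x < 0] `|` ([set x | S x <= 0] `|`
    \bigcup_n (w @^-1` A `&` `[0, y n]%classic)))).
  move=> x /= wAx; have [x0|x0] := ltP x 0; first by left.
  right; have [Sx|Sx] := leP (S x) 0; [by left|right].
  have [n nSx] : exists n, q n < S x.
    have := near_infty_natSinv_lt (PosNum Sx) => -[n _ /(_ n.+1)] /= h.
    by exists n; apply: h; rewrite /= leqnSn.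
  exists n => //; split => //=; rewrite in_itv/= x0/=.
  by rewrite leNgt; apply/negP => /ltW/(ccdf_ge_ni F); rewrite -/S Sy leNgt nSx.
apply: negligibleU; first exact: neg_negligible.
apply: negligibleU; first exact: ccdf_eq0_negligible.
apply: negligible_bigcup => n; apply/negligibleP.
  by apply: measurableI mwA _; exact: measurable_itv.
apply: (cond_mean_null_itv (yS n)) => //.
by rewrite Sy; case/andP : (q01 n.+1).
Qed.

End density_ccdf.

(** * The hybrid maximizer and its standard counterpart *)

Section hybrid_maximizer.
Context {R : realType} (F : distr R) (hF : valuation_distr F).
Variables (theta gamma : R).
Hypotheses (theta0 : 0 < theta) (gamma0 : 0 < gamma).
Let S := ccdf_ge F.

Let dF : has_density F. Proof. by case: hF. Qed.
Let sF : supp F `<=` [set x | 0 <= x]. Proof. by case: hF. Qed.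

Let ray_measurable (P : R -> Prop) : (forall x y, x <= y -> P x -> P y) ->
  measurable ([set x | P x] : set (measurableTypeR R)).
Proof.
move=> Pup; apply: is_interval_measurable => a b /= Pa _ c /andP[ac _].
exact: Pup Pa.
Qed.

(** This replaces the threshold [alpha], an infimum over the support, by a pointwise test on the
    tail mean. Monotonicity is asked only where the tail has mass, since [tail_mean] drops to 0
    beyond. *)
Lemma hybrid_purchase_probE (p : R) (B : set R) : 0 < p ->
  (forall x y, x <= y -> B x -> B y) ->
  (forall x y, supp F x -> x <= y -> 0 < S y ->
    (tail_mean F x <= tail_mean F y)%E) ->
  (forall x, supp F x -> 0 < S x ->
    B x <-> theta * p <= x /\ ((gamma * p)%:E <= tail_mean F x)%E) ->
  F B = hybrid_purchase_prob F theta gamma p.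
Proof.
move=> p0 Bup tmono BE; set al := alpha F gamma p.
(* The point [fine al] is removed because the infimum may fail the test itself; when [al] is
   infinite, [fine al] is 0, a harmless null point. *)
pose N := ~` supp F `|` ([set x | S x <= 0] `|` [set fine al]).
apply: (@eq_measure_negligible R _ _ F _ _ N).
- exact: ray_measurable.
- by apply: ray_measurable => x y xy /= /le_trans; apply; rewrite lee_fin.
- apply: negligibleU; first exact: supp_negligible.
  apply: negligibleU; first exact: ccdf_eq0_negligible.
  apply/negligibleP; first exact: measurable_set1.
  exact: density_set1.
move=> x /not_orP[/contrapT sx /not_orP[/negP]]; rewrite -ltNge => Sx /= xal.
rewrite BE// /tauH ge_max lee_fin -/al; split=> [[-> tx]/=|/andP[-> alx]].
  by apply: ereal_inf_lbound; exists x.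
split=> //.
have : (al < x%:E)%E.
  rewrite lt_neqAle alx andbT; apply/eqP => alE.
  by apply: xal; rewrite alE.
move=> /ereal_inf_lt[_ [y [sy ty] <-]]; rewrite lte_fin => yx.
by apply: le_trans ty _; exact: tmono (ltW yx) Sx.
Qed.

Lemma tail_mean_integrable (x : R) :
  F.-integrable setT (EFin : measurableTypeR R -> \bar R) -> 0 < S x ->
  tail_mean F x = (cond_mean F x)%:E.
Proof.
move=> intF Sx; rewrite /tail_mean tail_intE// (ccdf_itvcy dF)/= -EFinM.
by rewrite /cond_mean -/S Sx mulrC.
Qed.

Lemma tail_mean_not_integrable (x : R) :
  ~ F.-integrable setT (EFin : measurableTypeR R -> \bar R) ->
  0 <= x -> 0 < S x -> tail_mean F x = +oo%E.
Proof.
move=> nint x0 Sx; rewrite /tail_mean (ccdf_itvcy dF)/=.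
suff -> : (\int[F]_(v in `[x, +oo[%classic) v%:E = +oo)%E.
  by rewrite gt0_muley// lte_fin invr_gt0.
apply/eqP; rewrite -leye_eq leNgt; apply/negP => fin; apply: nint.
have mid (A : set (measurableTypeR R)) :
    measurable_fun A (EFin : measurableTypeR R -> \bar R).
  by apply: measurable_funTS; apply/measurable_EFinP; exact: measurable_id.
have F0 : F `]-oo, 0[%classic = 0%E.
  apply/negligibleP; first exact: measurable_itv.
  apply: negligibleS (neg_negligible dF sF) => v /=.
  by rewrite in_itv.
have m0 : measurable (`]-oo, 0[%classic : set (measurableTypeR R)).
  exact: measurable_itv.
apply/(negligible_integrable m0 measurableT (mid _) F0).
have -> : setT `\` `]-oo, 0[%classic =
    `[0, x[%classic `|` `[x, +oo[%classic :> set R.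
  apply/seteqP; split => v /=; rewrite !in_itv/= ?andbT.
    move=> [_ /negP]; rewrite -leNgt => v0.
    by case: (leP x v) => vx; [right|left; rewrite v0].
  move=> vx; split=> //; apply/negP; rewrite -leNgt.
  by case: vx => [/andP[]//|/(le_trans x0)].
have mx : measurable (`[x, +oo[%classic : set (measurableTypeR R)).
  exact: measurable_itv.
have m0x : measurable (`[0, x[%classic : set (measurableTypeR R)).
  exact: measurable_itv.
apply/integrableP; split; first exact: mid.
rewrite ge0_integral_setU//=; last 2 first.
- by apply: measurableT_comp => //; exact: mid.
- apply/disj_setPS => v /=; rewrite !in_itv/= => -[/andP[_ vx]].
  by rewrite leNgt vx.
apply: lte_add_pinfty; last first.
  rewrite (eq_integral (EFin : measurableTypeR R -> \bar R))// => v.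
  by rewrite inE/= in_itv/= andbT => xv; rewrite ger0_norm// (le_trans x0).
have le_x : (\int[F]_(v in `[0%R, x[%classic) `|v|%:E <=
             \int[F]_(v in `[0%R, x[%classic) cst x%:E v)%E.
  apply: ge0_le_integral => //=.
  - by apply: measurableT_comp => //; exact: mid.
  - by move=> v; rewrite in_itv/= lee_fin => /andP[v0 /ltW]; rewrite ger0_norm.
rewrite (le_lt_trans le_x)// integral_cst//; apply: lte_mul_pinfty => //.
by rewrite ltey_eq fin_num_measure.
Qed.

Lemma scaled_null (c : R) (f : R -> R) : 0 < c ->
  (forall A : set R, measurable A ->
    lebesgue_measure A = 0%E -> F (f @^-1` A) = 0%E) ->
  forall A : set R, measurable A -> lebesgue_measure A = 0%E ->
    F ((fun x => f x / c) @^-1` A) = 0%E.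
Proof.
move=> c0 fA A mA A0.
have mcA : measurable [set x | A (c^-1 * x)].
  rewrite -[X in measurable X]setTI.
  exact: (@mulrl_measurable R setT c^-1 measurableT A mA).
rewrite (_ : _ @^-1` A = f @^-1` [set x | A (c^-1 * x)]).
  by apply: fA => //; apply: lebesgue_null_scale; rewrite ?invr_gt0.
by apply/seteqP; split => x /=; rewrite mulrC.
Qed.

Hypothesis rF : regular F.

Lemma hybrid_equivalent_not_integrable :
  ~ F.-integrable setT (EFin : measurableTypeR R -> \bar R) ->
  exists G : distr R, [/\ valuation_distr G, regular G &
    forall p, 0 < p ->
      standard_purchase_prob G p = hybrid_purchase_prob F theta gamma p].
Proof.
move=> nint; pose T x := x / theta.
have Tnd : {homo T : x y / x <= y} by move=> x y; rewrite ler_pM2r ?invr_gt0.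
have [||||G [vG rG GE]] := pushforward_regular hF Tnd.
- by move=> x x0; rewrite divr_ge0// ltW.
- by apply: (scaled_null (f := id)) => // A; exact: has_density_null.
- move=> x p _; rewrite /T ltr_pdivlMr// => px.
  exists ((p * theta + x) / 2); first by lra.
  by rewrite ltr_pdivlMr//; lra.
- apply: (eq_concave_function _ _ (concave_scale (_ : 0 <= theta^-1) rF)).
  + exact: convex_itv01.
  + by move=> q _; rewrite /T /revenue_curve mulrC mulrA.
  + by rewrite invr_ge0 ltW.
exists G; split=> // p p0; rewrite GE; apply: hybrid_purchase_probE => //.
- by move=> x y xy /= /le_trans; apply; exact: Tnd.
- move=> x y sx xy Sy; rewrite !tail_mean_not_integrable//.
  + by rewrite (le_trans _ xy)//; exact: sF.
  + exact: sF.
  + by apply: lt_le_trans Sy _; exact: ccdf_ge_ni.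
- move=> x sx Sx /=; rewrite tail_mean_not_integrable ?leey//; last exact: sF.
  by rewrite /T ler_pdivlMr// mulrC; split => // -[].
Qed.

Lemma hybrid_equivalent_integrable :
  F.-integrable setT (EFin : measurableTypeR R -> \bar R) ->
  exists G : distr R, [/\ valuation_distr G, regular G &
    forall p, 0 < p ->
      standard_purchase_prob G p = hybrid_purchase_prob F theta gamma p].
Proof.
move=> intF; pose T x := Num.min (x / theta) (cond_mean F x / gamma).
have Tnd : {homo T : x y / x <= y}.
  move=> x y xy; rewrite /T le_min; apply/andP; split.
    by rewrite ge_min ler_pM2r ?invr_gt0// xy.
  by rewrite ge_min orbC ler_pM2r ?invr_gt0// cond_mean_nd.
have [||||G [vG rG GE]] := pushforward_regular hF Tnd.
- move=> x x0; rewrite /T le_min !divr_ge0 ?(ltW theta0) ?(ltW gamma0)//=.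
  exact: le_trans (cond_mean_ge dF intF x).
(* A minimum equals one of its two arguments, so the preimage lies in the union of two null
   preimages. *)
- move=> A mA A0.
  have idA := has_density_null dF.
  have n1 := scaled_null (f := id) theta0 idA mA A0.
  have n2 := scaled_null gamma0 (cond_mean_null dF sF intF) mA A0.
  have mpre (f : R -> R) : {homo f : x y / x <= y} ->
      measurable (f @^-1` A : set (measurableTypeR R)).
    move=> fnd; rewrite -[X in measurable X]setTI.
    exact: (nondecreasing_measurable measurableT fnd).
  have m1 : measurable
      ((fun x : R => x / theta) @^-1` A : set (measurableTypeR R)).
    by apply: mpre => x y; rewrite ler_pM2r ?invr_gt0.
  have m2 : measurable
      ((fun x : R => cond_mean F x / gamma) @^-1` A : set (measurableTypeR R)).
    by apply: mpre => x y xy; rewrite ler_pM2r ?invr_gt0// cond_mean_nd.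
  apply/negligibleP; first exact: mpre.
  apply: (@negligibleS _ _ _ F (((fun x => x / theta) @^-1` A) `|`
                               ((fun x => cond_mean F x / gamma) @^-1` A))).
    by move=> x /=; rewrite /T minEle; case: ifP => _; [left|right].
  by apply: negligibleU; apply/negligibleP.
- move=> x p Sx; rewrite /T lt_min !ltr_pdivlMr// => /andP[px pwx].
  have [y1 y1x pwy1] := cond_mean_left dF intF Sx pwx.
  (* The midpoint of [p * theta] and [x] handles the first branch of the minimum and [y1] the
     second; both conditions persist at larger points. *)
  exists (Num.max y1 ((p * theta + x) / 2)); first by rewrite gt_max y1x/=; lra.
  rewrite lt_min !ltr_pdivlMr//; apply/andP; split.
    by rewrite lt_max; apply/orP; right; lra.
  by apply: lt_le_trans pwy1 _; apply: cond_mean_nd => //; rewrite le_max lexx.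
- have itheta0 : 0 <= theta^-1 by rewrite invr_ge0 ltW.
  have igamma0 : 0 <= gamma^-1 by rewrite invr_ge0 ltW.
  have := concave_min (concave_scale itheta0 rF)
                      (concave_scale igamma0 (concave_tail_int dF intF)).
  apply: eq_concave_function; first exact: convex_itv01.
  move=> q /[!inE]/= q01.
  have q0 : 0 < q by move: q01; rewrite in_itv/= => /andP[].
  rewrite /T minr_pMr ?ltW// /revenue_curve; congr (Num.min _ _).
    by rewrite mulrC mulrA.
  (* The tail probability at the quantile is [q], so [q] times the tail mean there is the tail
     integral. *)
  rewrite -cond_mean_tail_int// (ccdf_quantile dF)//.
  by rewrite mulrC mulrA.
exists G; split=> // p p0; rewrite GE; apply: hybrid_purchase_probE => //.
- by move=> x y xy /= /le_trans; apply; exact: Tnd.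
- move=> x y sx xy Sy; have Sx := lt_le_trans Sy (ccdf_ge_ni F xy).
  by rewrite !tail_mean_integrable// lee_fin cond_mean_nd.
- move=> x sx Sx /=; rewrite tail_mean_integrable// lee_fin.
  rewrite /T le_min !ler_pdivlMr// ![p * _]mulrC.
  by split => /andP.
Qed.

End hybrid_maximizer.

Theorem lemma3p2 (R : realType) (theta gamma : R)
    (htheta : 0 < theta < 1) (hgamma : 1 <= gamma)
    (F : distr R) (hF : valuation_distr F) (hFreg : regular F) :
  exists G : distr R,
    [/\ valuation_distr G,
        regular G &
        forall p : R, 0 < p ->
          standard_purchase_prob G p = hybrid_purchase_prob F theta gamma p /\
          standard_revenue G p = hybrid_revenue F theta gamma p].
Proof.
have [theta0 _] := andP htheta.
have gamma0 : 0 < gamma by rewrite (lt_le_trans ltr01).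
suff [G [vG rG GE]] : exists G : distr R, [/\ valuation_distr G, regular G &
    forall p, 0 < p ->
      standard_purchase_prob G p = hybrid_purchase_prob F theta gamma p].
  by exists G; split=> // p /GE pE; rewrite /standard_revenue /hybrid_revenue pE.
have [intF|nintF] :=
    pselect (F.-integrable setT (EFin : measurableTypeR R -> \bar R)).
- exact: hybrid_equivalent_integrable.
- exact: hybrid_equivalent_not_integrable.
Qed.
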